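(* Let $m\in\mathbb{N}$, $q=3^{2m+1}$, $G=A_8(q)$, $U={}^2G_2^{syl}(q)$, and for $A\in V$ let $$[A]=\frac1{|U|}\sum_{u\in U}\overline{\chi_A(u)}\,u\in\mathbb{C}U,$$ where $\chi_A(u)=\vartheta(\kappa(A,f(u)))=\overline{\chi_{-A}(u)}$. Then the set $\{[A]: A\in V\}$ is a $\mathbb{C}$-basis of the complex group algebra $\mathbb{C}U$. For all $g\in G$ and $A\in V$ let $$[A]*g=\chi_{A.g}(g)\,[A.g]=\vartheta(\kappa(A.g,f(g)))\,[A.g].$$ Then (extending $*$ linearly) $\mathbb{C}U$ is a monomial $\mathbb{C}G$-module. The restriction of the $*$-operation to $U$ is the usual right multiplication of $U$ on $\mathbb{C}U$, i.e. $$[A]*u=[A]u=\frac1{|U|}\sum_{y\in U}\overline{\chi_A(y)}\,yu\qquad\text{for all }u\in U,\ A\in V.$$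
   Context: Let $m\in\mathbb{N}=\{0,1,2,\dots\}$, $q=3^{2m+1}$, $\theta=3^m$; $e_{ij}=e_{i,j}$ are the $8\times8$ matrix units over $\mathbb{F}_q$. $A_8(q)$ is the group of upper unitriangular $8\times8$ matrices over $\mathbb{F}_q$. Put $E_1=(e_{1,2}-e_{7,8})+(e_{3,4}-e_{5,6})+(e_{3,5}-e_{4,6})$, $E_2=e_{2,3}-e_{6,7}$, $E_3=-(e_{1,3}-e_{6,8})+(e_{2,4}-e_{5,7})+(e_{2,5}-e_{4,7})$, $E_4=-(e_{1,4}-e_{5,8})-(e_{2,6}-e_{3,7})-(e_{1,5}-e_{4,8})$, $E_5=-(e_{1,6}-e_{3,8})$, $E_6=-(e_{1,7}-e_{2,8})$, and $y_i(t)=I_8+tE_i+\tfrac12t^2E_i^2$. For $t_1,t_3,t_4\in\mathbb{F}_q$ set $Y(t_1,t_3,t_4)=y_2(t_1^{3\theta})y_1(t_1)y_3(t_3)y_4(t_4)y_5(t_3^{3\theta}+t_1^{3\theta+3})y_6(t_4^{3\theta}+t_1^{6\theta+3})$. Then $U={}^2G_2^{syl}(q)=\{Y(t_1,t_3,t_4): t_i\in\mathbb{F}_q\}$ is a subgroup of $A_8(q)$ of order $q^3$ (a Sylow $3$-subgroup of the Ree group ${}^2G_2(q)$). $V=\mathbb{F}_qe_{12}\oplus\mathbb{F}_qe_{13}\oplus\mathbb{F}_qe_{14}$; $\pi(B)=B_{12}e_{12}+B_{13}e_{13}+B_{14}e_{14}$ for an $8\times 8$ matrix $B$; $f=\pi|_G:G\to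 V$; $\kappa(A,B)=\mathrm{tr}(A^\top B)$; $A.g=\pi(Ag^{-\top})$ for $A\in V$, $g\in G$ (an action of $G$ on $V$). $\vartheta:\mathbb{F}_q^+\to\mathbb{C}^*$ is a fixed nontrivial linear character, and $\chi_A(g)=\vartheta(\kappa(A,f(g)))$ for $A\in V$, $g\in G$. A module is monomial if it has a basis that every group element permutes up to nonzero scalars. *)

(* Defs.v *)
From HB Require Import structures.
From mathcomp Require Import all_boot all_order all_fingroup all_algebra all_field.
From mathcomp Require Import ring.
From mathcomp Require Import reals.
From mathcomp.real_closed Require Export complex.

Set Implicit Arguments.
Unset Strict Implicit.
Unset Printing Implicit Defensive.

Import GroupScope GRing.Theory.
Local Open Scope ring_scope.

(* The group algebra of a finite group: functions with the convolution
   product.  The group algebra of a subgroup H : {group gT} is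
   galg C (subg_of H). *)
Definition galg (C : fieldType) (gT : finGroupType) : Type := {ffun gT -> C^o}.

Section GroupAlgebra.
Variables (C : fieldType) (gT : finGroupType).

HB.instance Definition _ := Vector.copy (galg C gT) {ffun gT -> C^o}.

Implicit Types (a b c : galg C gT) (g h : gT).

Definition gelt g : galg C gT := [ffun h => (h == g)%:R].

Definition galg_mul a b : galg C gT :=
  [ffun g => \sum_h (a h : C) * (b (h^-1 * g)%g : C)].

Lemma galg_mulA : associative galg_mul.
Proof.
move=> a b c; apply/ffunP=> g; rewrite !ffunE.
transitivity (\sum_h \sum_k (a h : C) * (b (h^-1 * k)%g : C) * c (k^-1 * g)%g).
  apply: eq_bigr => h _; rewrite ffunE mulr_sumr.
  rewrite [RHS](reindex_inj (mulgI h)) /=; apply: eq_bigr => k _.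
  by rewrite mulKg invMg mulgA mulrA.
rewrite exchange_big; apply: eq_bigr => k _.
by rewrite ffunE mulr_suml.
Qed.

Lemma galg_mul1l : left_id (gelt 1%g) galg_mul.
Proof.
move=> a; apply/ffunP=> g; rewrite ffunE (bigD1 1%g) //= ffunE eqxx mul1r.
rewrite invg1 mul1g big1 ?addr0 // => h /negPf h1.
by rewrite ffunE h1 mul0r.
Qed.

Lemma galg_mul1r : right_id (gelt 1%g) galg_mul.
Proof.
move=> a; apply/ffunP=> g; rewrite ffunE (bigD1 g) //= ffunE mulVg eqxx mulr1.
rewrite big1 ?addr0 // => h hg.
by rewrite ffunE -eq_mulVg1 (negPf hg) mulr0.
Qed.

Lemma galg_mulDl : left_distributive galg_mul +%R.
Proof.
move=> a b c; apply/ffunP=> g; rewrite !ffunE -big_split.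
by apply: eq_bigr => h _; rewrite ffunE mulrDl.
Qed.

Lemma galg_mulDr : right_distributive galg_mul +%R.
Proof.
move=> a b c; apply/ffunP=> g; rewrite !ffunE -big_split.
by apply: eq_bigr => h _; rewrite ffunE mulrDr.
Qed.

Lemma galg_1_neq0 : gelt 1%g != 0.
Proof.
by apply/eqP=> /ffunP/(_ 1%g)/eqP; rewrite !ffunE eqxx oner_eq0.
Qed.

HB.instance Definition _ := GRing.Zmodule_isNzRing.Build (galg C gT)
  galg_mulA galg_mul1l galg_mul1r galg_mulDl galg_mulDr galg_1_neq0.

Lemma galg_scaleAl (k : C) a b : k *: (a * b) = k *: a * b.
Proof.
apply/ffunP=> g; rewrite !ffunE scaler_sumr; apply: eq_bigr => h _.
by rewrite ffunE scalerAl.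
Qed.

HB.instance Definition _ :=
  GRing.Lmodule_isLalgebra.Build C (galg C gT) galg_scaleAl.

Lemma galg_scaleAr (k : C) a b : k *: (a * b) = a * (k *: b).
Proof.
apply/ffunP=> g; rewrite !ffunE scaler_sumr; apply: eq_bigr => h _.
by rewrite ffunE scalerAr.
Qed.

HB.instance Definition _ :=
  GRing.Lalgebra_isAlgebra.Build C (galg C gT) galg_scaleAr.

Lemma gelt1 : gelt 1%g = 1 :> galg C gT. Proof. by []. Qed.

Lemma geltM g h : gelt (g * h)%g = gelt g * gelt h.
Proof.
apply/ffunP=> k; rewrite !ffunE (bigD1 g) //= !ffunE eqxx mul1r.
rewrite big1 ?addr0 => [|j /negPf jg]; last by rewrite ffunE jg mul0r.
by rewrite -[in RHS](inj_eq (mulgI g)) mulKVg.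
Qed.

(* Right module over the group algebra, the scalars C acting through it. *)
Definition right_gmodule (M : vectType C) (op : M -> galg C gT -> M) : Prop :=
  [/\ forall a, linear (op^~ a),
      forall x, linear (op x),
      forall x, op x 1 = x
    & forall x a b, op x (a * b) = op (op x a) b].

Definition monomial_gmodule (M : vectType C) (op : M -> galg C gT -> M) : Prop :=
  right_gmodule op /\
  exists (n : nat) (b : n.-tuple M),
    basis_of fullv b /\
    forall g, exists (s : 'S_n) (c : 'I_n -> C),
      forall i, c i != 0 /\ op (tnth b i) (gelt g) = c i *: tnth b (s i).

End GroupAlgebra.

Section Ree.
Variable F : finFieldType.

(* Rows and columns are numbered 1, ..., 8. *)
Definition ix (i : nat) : 'I_8 := inord i.-1.

Definition emx (i j : nat) : 'M[F]_8 := delta_mx (ix i) (ix j).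

Definition Emx (i : nat) : 'M[F]_8 :=
  match i with
  | 1 => (emx 1 2 - emx 7 8) + (emx 3 4 - emx 5 6) + (emx 3 5 - emx 4 6)
  | 2 => emx 2 3 - emx 6 7
  | 3 => - (emx 1 3 - emx 6 8) + (emx 2 4 - emx 5 7) + (emx 2 5 - emx 4 7)
  | 4 => - (emx 1 4 - emx 5 8) - (emx 2 6 - emx 3 7) - (emx 1 5 - emx 4 8)
  | 5 => - (emx 1 6 - emx 3 8)
  | 6 => - (emx 1 7 - emx 2 8)
  | _ => 0
  end.

Definition ymx (i : nat) (t : F) : 'M[F]_8 :=
  1%:M + t *: Emx i + (2^-1 * t ^+ 2) *: (Emx i *m Emx i).

Definition theta (m : nat) : nat := 3 ^ m.

Definition Ymx (m : nat) (t1 t3 t4 : F) : 'M[F]_8 :=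
  let th := theta m in
  ymx 2 (t1 ^+ (3 * th)) *m ymx 1 t1 *m ymx 3 t3 *m ymx 4 t4
  *m ymx 5 (t3 ^+ (3 * th) + t1 ^+ (3 * th + 3))
  *m ymx 6 (t4 ^+ (3 * th) + t1 ^+ (6 * th + 3)).

Definition unitri_mx (B : 'M[F]_8) : bool :=
  [forall i : 'I_8, B i i == 1] &&
  [forall i : 'I_8, forall j : 'I_8, (j < i)%N ==> (B i j == 0)].

Definition unitri_set : {set {'GL_8[F]}} :=
  [set g : {'GL_8[F]} | unitri_mx (GLval g)].

Lemma unitri_group_set : group_set unitri_set.
Proof.
have unitriP (B : 'M[F]_8) : reflect
    ((forall i : 'I_8, B i i = 1) /\ forall i j : 'I_8, (j < i)%N -> B i j = 0)
    (unitri_mx B).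
  apply: (iffP andP) => [[/forallP d /forallP l]|[d l]]; split.
  - by move=> i; apply/eqP.
  - by move=> i j ji; have /forallP/(_ j) := l i; rewrite ji => /eqP.
  - by apply/forallP=> i; rewrite d.
  - by do 2!apply/forallP=> ?; apply/implyP=> /l ->.
apply/group_setP; split=> [|g h].
  rewrite inE; apply/unitriP; split=> [i|i j ji]; rewrite GL_1E mxE ?eqxx //.
  by rewrite -val_eqE /= gtn_eqF.
rewrite !inE => /unitriP[gd gl] /unitriP[hd hl].
apply/unitriP; rewrite GL_MxE; split=> [i|i j ji]; rewrite mxE.
  rewrite (bigD1 i) //= gd hd mulr1 big1 ?addr0 // => k; rewrite -val_eqE /=.
  by case: ltngtP => // [/gl|/hl] ->; rewrite ?mul0r ?mulr0.
rewrite big1 // => k _; case: (ltnP k i) => [/gl ->|ik]; first by rewrite mul0r.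
by rewrite hl ?mulr0 // (leq_trans ji).
Qed.

Definition unitri_group : {group {'GL_8[F]}} := Group unitri_group_set.

Definition ree_syl_set (m : nat) : {set {'GL_8[F]}} :=
  [set g : {'GL_8[F]} | [exists t1, exists t3, exists t4, GLval g == Ymx m t1 t3 t4]].

(* The product formula in U is checked by computing with matrices of formal
   polynomials over 'F_3 in twelve variables. *)
Definition poly3 := seq (nat * seq nat).

Fixpoint eadd (e1 e2 : seq nat) : seq nat :=
  match e1, e2 with
  | n1 :: f1, n2 :: f2 => (n1 + n2)%N :: eadd f1 f2
  | [::], _ => e2
  | _, [::] => e1
  end.

Fixpoint pins (c : nat) (e : seq nat) (p : poly3) : poly3 :=
  match p with
  | [::] => if (c %% 3 == 0)%N then [::] else [:: ((c %% 3)%N, e)]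
  | (d, f) :: p' =>
      if e == f then
        let r := ((c + d) %% 3)%N in if r == 0%N then p' else (r, f) :: p'
      else (d, f) :: pins c e p'
  end.

Definition pnorm (p : poly3) : poly3 := foldr (fun n => pins n.1 n.2) [::] p.
Definition pv (i : nat) : poly3 := [:: (1%N, ncons i 0%N (1%N :: nseq (11 - i) 0%N))].
Definition pc (c : nat) : poly3 := if c is 0 then [::] else [:: (c, [::])].
Definition padd (p q : poly3) : poly3 := pnorm (p ++ q).
Definition popp (p : poly3) : poly3 := [seq ((2 * n.1)%N, n.2) | n <- p].
Definition pmul (p q : poly3) : poly3 :=
  pnorm [seq ((n.1 * n'.1)%N, eadd n.2 n'.2) | n <- p, n' <- q].
Definition peq (p q : poly3) : bool := nilp (padd p (popp q)).

Definition pmx := seq (seq poly3).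
Definition pent (A : pmx) (i j : nat) : poly3 := nth [::] (nth [::] A i) j.
Definition ptab (f : nat -> nat -> poly3) : pmx :=
  mkseq (fun i => mkseq (f i) 8) 8.
Definition pmx_eq (A B : pmx) : bool :=
  all (fun i => all (fun j => peq (pent A i j) (pent B i j)) (iota 0 8))
    (iota 0 8).

Definition pdelta a b : pmx := ptab (fun i j => pc ((i == a.-1) && (j == b.-1))).
Definition pmx1 : pmx := ptab (fun i j => pc (i == j)).
Definition pmxD (A B : pmx) : pmx := ptab (fun i j => padd (pent A i j) (pent B i j)).
Definition pmxN (A : pmx) : pmx := ptab (fun i j => popp (pent A i j)).
Definition pmxZ p (A : pmx) : pmx := ptab (fun i j => pmul p (pent A i j)).
Definition pmxM (A B : pmx) : pmx := ptab (fun i j =>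
  foldr (fun k => padd (pmul (pent A i k) (pent B k j))) [::] (iota 0 8)).
Local Notation "A +' B" := (pmxD A B) (at level 50, left associativity).
Local Notation "A -' B" := (pmxD A (pmxN B)) (at level 50, left associativity).

Definition pE (i : nat) : pmx :=
  match i with
  | 1 => (pdelta 1 2 -' pdelta 7 8) +' (pdelta 3 4 -' pdelta 5 6)
           +' (pdelta 3 5 -' pdelta 4 6)
  | 2 => pdelta 2 3 -' pdelta 6 7
  | 3 => pmxN (pdelta 1 3 -' pdelta 6 8) +' (pdelta 2 4 -' pdelta 5 7)
           +' (pdelta 2 5 -' pdelta 4 7)
  | 4 => pmxN (pdelta 1 4 -' pdelta 5 8) -' (pdelta 2 6 -' pdelta 3 7)
           -' (pdelta 1 5 -' pdelta 4 8)
  | 5 => pmxN (pdelta 1 6 -' pdelta 3 8)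
  | 6 => pmxN (pdelta 1 7 -' pdelta 2 8)
  | _ => pmxN pmx1 +' pmx1
  end.

Definition py i p : pmx :=
  pmx1 +' pmxZ p (pE i) +' pmxZ (popp (pmul p p)) (pmxM (pE i) (pE i)).

Definition pcube p := pmul p (pmul p p).

Definition pY t1 t3 t4 A1 A3 A4 : pmx :=
  pmxM (pmxM (pmxM (pmxM (pmxM (py 2 A1) (py 1 t1)) (py 3 t3)) (py 4 t4))
    (py 5 (padd A3 (pmul A1 (pcube t1)))))
    (py 6 (padd A4 (pmul (pmul A1 A1) (pcube t1)))).

Definition reeY (t1 t3 t4 A1 A3 A4 : F) : 'M[F]_8 :=
  ymx 2 A1 *m ymx 1 t1 *m ymx 3 t3 *m ymx 4 t4 *m ymx 5 (A3 + A1 * t1 ^+ 3)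
    *m ymx 6 (A4 + A1 ^+ 2 * t1 ^+ 3).

Section Char3.
Hypothesis F3 : 3%:R = 0 :> F.
Variable x : seq F.

Fixpoint eev (x : seq F) (e : seq nat) : F :=
  match x, e with a :: x', n :: e' => a ^+ n * eev x' e' | _, _ => 1 end.
Definition pev (p : poly3) : F := \sum_(n <- p) n.1%:R * eev x n.2.
Definition pmxev (A : pmx) : 'M[F]_8 := \matrix_(i < 8, j < 8) pev (pent A i j).

Lemma half_char3 : 2^-1 = -1 :> F.
Proof.
have two0 : 2%:R != 0 :> F.
  apply/eqP=> two0; have /eqP := oner_neq0 F; apply.
  have -> : 1 = 3%:R - 2%:R :> F by ring.
  by rewrite F3 two0 subrr.
by apply: (mulfI two0); rewrite divff // -[RHS]addr0 -F3; ring.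
Qed.

Lemma natr_mod3 n : (n %% 3)%N%:R = n%:R :> F.
Proof. by rewrite [in RHS](divn_eq n 3) natrD natrM F3 mulr0 add0r. Qed.

Lemma eevD e1 e2 : eev x (eadd e1 e2) = eev x e1 * eev x e2.
Proof.
elim: x e1 e2 => [|a x' IH] [|n1 e1] [|n2 e2] /=; rewrite ?mulr1 ?mul1r //.
by rewrite IH exprD; ring.
Qed.

Lemma pev_cons c e p : pev ((c, e) :: p) = c%:R * eev x e + pev p.
Proof. exact: big_cons. Qed.

Lemma pins_ev c e p : pev (pins c e p) = c%:R * eev x e + pev p.
Proof.
elim: p => [|[d f] p IH] /=.
  case: eqP => [c0|_]; last by rewrite pev_cons natr_mod3.
  by rewrite -natr_mod3 c0 mul0r add0r.
case: (eqVneq e f) => [->|_]; last by rewrite !pev_cons IH addrCA.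
rewrite !pev_cons addrA -mulrDl -natrD -natr_mod3.
by case: eqP => [->|_]; rewrite ?mul0r ?add0r ?pev_cons.
Qed.

Lemma pnorm_ev p : pev (pnorm p) = pev p.
Proof. by elim: p => [|[c e] p IH] //=; rewrite pins_ev pev_cons IH. Qed.

Lemma pc_ev c : pev (pc c) = c%:R.
Proof.
case: c => [|c]; first exact: big_nil.
by rewrite pev_cons /pev big_nil addr0; case: x; rewrite /= mulr1.
Qed.

Lemma padd_ev p q : pev (padd p q) = pev p + pev q.
Proof. by rewrite pnorm_ev /pev big_cat. Qed.

Lemma popp_ev p : pev (popp p) = - pev p.
Proof.
rewrite /pev big_map -sumrN; apply: eq_bigr => n _ /=.
by apply: subr0_eq; rewrite natrM -[RHS](mul0r (n.1%:R * eev x n.2)) -F3; ring.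
Qed.

Lemma pmul_ev p q : pev (pmul p q) = pev p * pev q.
Proof.
rewrite pnorm_ev /pev big_allpairs_dep mulr_suml; apply: eq_bigr => n _.
by rewrite mulr_sumr; apply: eq_bigr => n' _ /=; rewrite natrM eevD; ring.
Qed.

Lemma peq_ev p q : peq p q -> pev p = pev q.
Proof.
move=> /nilP pq0; apply: subr0_eq.
by rewrite -popp_ev -padd_ev pq0 /pev big_nil.
Qed.

Lemma pv_ev i : (i < size x)%N -> pev (pv i) = x`_i.
Proof.
have z y k : eev y (nseq k 0%N) = 1.
  by elim: k y => [|k IH] [|a y] //=; rewrite IH mulr1.
rewrite pev_cons /pev big_nil addr0 mul1r; move: (11 - i)%N => k.
elim: i x => [|i IH] [|a y] //=; first by rewrite z mulr1.
by rewrite mul1r; apply: IH.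
Qed.

Lemma ptabE f i j : (i < 8)%N -> (j < 8)%N -> pent (ptab f) i j = f i j.
Proof. by move=> i8 j8; rewrite /pent !nth_mkseq. Qed.

Lemma pmx_eq_ev A B : pmx_eq A B -> pmxev A = pmxev B.
Proof.
move=> /allP AB; apply/matrixP=> i j; rewrite !mxE.
have /AB/allP/(_ (val j)) : val i \in iota 0 8 by rewrite mem_iota ltn_ord.
by rewrite mem_iota ltn_ord => /(_ isT)/peq_ev.
Qed.

Lemma pdelta_ev a b : (a.-1 < 8)%N -> (b.-1 < 8)%N -> pmxev (pdelta a b) = emx a b.
Proof.
move=> a8 b8; apply/matrixP=> i j.
by rewrite !mxE ptabE // pc_ev -!val_eqE /= !inordK.
Qed.

Lemma pmx1_ev : pmxev pmx1 = 1%:M.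
Proof. by apply/matrixP=> i j; rewrite !mxE ptabE // pc_ev. Qed.

Lemma pmxD_ev A B : pmxev (A +' B) = pmxev A + pmxev B.
Proof. by apply/matrixP=> i j; rewrite !mxE ptabE // padd_ev. Qed.

Lemma pmxN_ev A : pmxev (pmxN A) = - pmxev A.
Proof. by apply/matrixP=> i j; rewrite !mxE ptabE // popp_ev. Qed.

Lemma pmxZ_ev p A : pmxev (pmxZ p A) = pev p *: pmxev A.
Proof. by apply/matrixP=> i j; rewrite !mxE ptabE // pmul_ev. Qed.

Lemma pmxM_ev A B : pmxev (pmxM A B) = pmxev A *m pmxev B.
Proof.
apply/matrixP=> i j; rewrite !mxE ptabE // !big_ord_recl big_ord0 !mxE.
by rewrite [foldr _ _ _]/= !padd_ev !pmul_ev [pev [::]]big_nil.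
Qed.

Lemma pE_ev i : pmxev (pE i) = Emx i.
Proof.
by case: i => [|[|[|[|[|[|[|i]]]]]]];
  rewrite /pE !(pmxD_ev, pmxN_ev, pdelta_ev, pmx1_ev) ?addNr.
Qed.

Lemma py_ev i p : pmxev (py i p) = ymx i (pev p).
Proof.
rewrite !(pmxD_ev, pmxZ_ev, pmxM_ev, pmx1_ev, pE_ev) popp_ev pmul_ev.
by rewrite /ymx half_char3 mulN1r.
Qed.

Lemma pY_ev t1 t3 t4 A1 A3 A4 : pmxev (pY t1 t3 t4 A1 A3 A4) =
  reeY (pev t1) (pev t3) (pev t4) (pev A1) (pev A3) (pev A4).
Proof. by rewrite !(pmxM_ev, py_ev, padd_ev, pmul_ev). Qed.

End Char3.

Lemma reeY_mul t1 t3 t4 A1 A3 A4 s1 s3 s4 B1 B3 B4 : 3%:R = 0 :> F ->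
  reeY t1 t3 t4 A1 A3 A4 *m reeY s1 s3 s4 B1 B3 B4 =
  reeY (t1 + s1) (t3 + s3 - t1 * B1)
    (t4 + s4 - t3 * s1 + t1 * s1 * B1 - t1 * t1 * B1)
    (A1 + B1) (A3 + B3 - A1 * (s1 * (s1 * s1)))
    (A4 + B4 - A3 * B1 + A1 * B1 * (s1 * (s1 * s1))
       - A1 * A1 * (s1 * (s1 * s1))).
Proof.
move=> F3.
pose x := [:: t1; t3; t4; A1; A3; A4; s1; s3; s4; B1; B3; B4].
have v i : (i < 12)%N -> x`_i = pev x (pv i) by move=> ?; rewrite pv_ev.
rewrite -[t1]/x`_0 -[t3]/x`_1 -[t4]/x`_2 -[A1]/x`_3 -[A3]/x`_4 -[A4]/x`_5.
rewrite -[s1]/x`_6 -[s3]/x`_7 -[s4]/x`_8 -[B1]/x`_9 -[B3]/x`_10 -[B4]/x`_11.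
rewrite !v // -!(pY_ev F3) -(pmxM_ev F3).
pose sub p q := padd p (popp q); pose c := pmul (pv 6) (pmul (pv 6) (pv 6)).
pose z := pY (padd (pv 0) (pv 6))
  (sub (padd (pv 1) (pv 7)) (pmul (pv 0) (pv 9)))
  (sub (padd (sub (padd (pv 2) (pv 8)) (pmul (pv 1) (pv 6)))
     (pmul (pmul (pv 0) (pv 6)) (pv 9))) (pmul (pmul (pv 0) (pv 0)) (pv 9)))
  (padd (pv 3) (pv 9)) (sub (padd (pv 4) (pv 10)) (pmul (pv 3) c))
  (sub (padd (sub (padd (pv 5) (pv 11)) (pmul (pv 4) (pv 9)))
     (pmul (pmul (pv 3) (pv 9)) c)) (pmul (pmul (pv 3) (pv 3)) c)).
transitivity (pmxev x z); first by apply: (pmx_eq_ev F3); vm_compute.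
by rewrite (pY_ev F3) !(padd_ev F3, popp_ev F3, pmul_ev F3).
Qed.

Lemma reeY_0 : 3%:R = 0 :> F -> reeY 0 0 0 0 0 0 = 1%:M.
Proof.
move=> F3; have p0 : 0 = pev [::] [::] by rewrite /pev big_nil.
rewrite p0 -(pY_ev F3) -(pmx1_ev [::]); apply: (pmx_eq_ev F3).
by vm_compute.
Qed.

Lemma reeY_unitri t1 t3 t4 A1 A3 A4 : 3%:R = 0 :> F ->
  unitri_mx (reeY t1 t3 t4 A1 A3 A4).
Proof.
move=> F3; pose x := [:: t1; t3; t4; A1; A3; A4; 0; 0; 0; 0; 0; 0].
have v i : (i < 12)%N -> x`_i = pev x (pv i) by move=> ?; rewrite pv_ev.
rewrite -[t1]/x`_0 -[t3]/x`_1 -[t4]/x`_2 -[A1]/x`_3 -[A3]/x`_4 -[A4]/x`_5.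
rewrite !v // -(pY_ev F3); set A := pY _ _ _ _ _ _.
have /allP At : all (fun i => peq (pent A i i) (pc 1) &&
    all (fun j => peq (pent A i j) [::]) (iota 0 i)) (iota 0 8) by vm_compute.
have {}At (i : 'I_8) := At (val i) (etrans (mem_iota 0 8 i) (ltn_ord i)).
apply/andP; split; apply/forallP=> i; have /andP[Ad /allP Al] := At i.
  by rewrite mxE (peq_ev F3 _ Ad) pc_ev.
apply/forallP=> j; apply/implyP=> ji.
have /(peq_ev F3 x) : peq (pent A i j) [::] by apply: Al; rewrite mem_iota.
by rewrite mxE => ->; rewrite /pev big_nil.
Qed.

Section Group.
Variable m : nat.
Hypothesis cardF : #|F| = (3 ^ (2 * m + 1))%N.

Let pchar3 : 3 \in [pchar F]. Proof. exact: card_finPcharP cardF _. Qed.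

Let F3 : 3%:R = 0 :> F. Proof. exact: pcharf0. Qed.

Let sg (x : F) := x ^+ (3 * theta m).

Let sgE x : sg x = x ^+ (3 ^ m.+1). Proof. by rewrite /sg /theta expnS. Qed.

Let sgD x y : sg (x + y) = sg x + sg y.
Proof.
by rewrite !sgE exprDn_pchar // pnatX (eq_pnat _ (pcharf_eq pchar3)) pnat_id.
Qed.

Let sgN x : sg (- x) = - sg x.
Proof.
by rewrite !sgE exprNn_pchar // pnatX (eq_pnat _ (pcharf_eq pchar3)) pnat_id.
Qed.

Let sgM x y : sg (x * y) = sg x * sg y. Proof. exact: exprMn. Qed.

Let sgK x : sg (sg x) = x ^+ 3.
Proof.
rewrite !sgE -exprM -expnD (_ : m.+1 + m.+1 = (2 * m + 1).+1)%N; last first.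
  by rewrite addSn addnS addn1 mul2n addnn.
by rewrite expnSr exprM -cardF expf_card.
Qed.

Lemma YmxE t1 t3 t4 : Ymx m t1 t3 t4 = reeY t1 t3 t4 (sg t1) (sg t3) (sg t4).
Proof.
rewrite /Ymx /reeY /sg -exprM (_ : 3 * theta m * 2 = 6 * theta m)%N.
  by rewrite -!exprD.
by rewrite mulnAC.
Qed.

Lemma Ymx_mul t1 t3 t4 s1 s3 s4 :
  Ymx m t1 t3 t4 *m Ymx m s1 s3 s4 =
  Ymx m (t1 + s1) (t3 + s3 - t1 * sg s1)
    (t4 + s4 - t3 * s1 + t1 * s1 * sg s1 - t1 * t1 * sg s1).
Proof. by rewrite !YmxE (reeY_mul _ _ _ _ _ _ _ _ _ _ _ _ F3) !(sgD, sgN, sgM, sgK). Qed.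

Lemma Ymx_0 : Ymx m 0 0 0 = 1%:M.
Proof.
have sg0 : sg 0 = 0 by apply: (addrI (sg 0)); rewrite -sgD !addr0.
by rewrite YmxE sg0 reeY_0.
Qed.

Lemma ree_syl_group_set : group_set (ree_syl_set m).
Proof.
apply/group_setP; split=> [|g h].
  rewrite inE; do 3!(apply/existsP; exists 0).
  by rewrite Ymx_0.
rewrite !inE => /existsP[t1 /existsP[t3 /existsP[t4 /eqP gE]]].
move=> /existsP[s1 /existsP[s3 /existsP[s4 /eqP hE]]].
rewrite GL_MxE gE hE Ymx_mul.
by do 3!(apply/existsP; eexists); apply: eqxx.
Qed.

Definition ree_syl_group : {group {'GL_8[F]}} := Group ree_syl_group_set.

Lemma ree_syl_sub : ree_syl_group \subset unitri_group.
Proof.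
apply/subsetP=> g; rewrite !inE.
case/existsP=> t1 /existsP[t3 /existsP[t4 /eqP ->]].
by rewrite YmxE reeY_unitri.
Qed.

Lemma mem_ree_syl t1 t3 t4 :
  exists2 u, u \in ree_syl_group & GLval u = Ymx m t1 t3 t4.
Proof.
have YV : Ymx m t1 t3 t4 \in unitmx.
  rewrite YmxE; have /andP[/forallP d /forallP l] :=
    reeY_unitri t1 t3 t4 (sg t1) (sg t3) (sg t4) F3.
  rewrite -unitmx_tr unitmxE det_trig.
    by rewrite big1 ?unitr1 // => i _; rewrite mxE (eqP (d i)).
  apply/is_trig_mxP=> i j ij; rewrite mxE.
  by have /forallP/(_ i) := l j; rewrite ij => /eqP.
exists (Sub (Ymx m t1 t3 t4) YV : {'GL_8[F]}); last exact: SubK.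
by rewrite inE; do 3!(apply/existsP; eexists); apply/eqP/SubK.
Qed.

End Group.

Definition Vsp : {vspace 'M[F]_8} := (<[emx 1 2]> + <[emx 1 3]> + <[emx 1 4]>)%VS.

Definition projV (B : 'M[F]_8) : 'M[F]_8 :=
  B (ix 1) (ix 2) *: emx 1 2 + B (ix 1) (ix 3) *: emx 1 3
  + B (ix 1) (ix 4) *: emx 1 4.

Definition fV (g : {'GL_8[F]}) : 'M[F]_8 := projV (GLval g).

Definition kappa (A B : 'M[F]_8) : F := \tr (A^T *m B).

(* The action A.g. *)
Definition actV (A : 'M[F]_8) (g : {'GL_8[F]}) : 'M[F]_8 :=
  projV (A *m (invmx (GLval g))^T).

Section Characters.
Variables (C : numClosedFieldType) (vth : F -> C).

Definition nontrivial_linear_char : Prop :=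
  [/\ forall x, vth x != 0,
      forall x y, vth (x + y) = vth x * vth y
    & exists x, vth x != 1].

Definition chi (A : 'M[F]_8) (g : {'GL_8[F]}) : C := vth (kappa A (fV g)).

(* The element [A] of the group algebra of U. *)
Definition lcb (U : {group {'GL_8[F]}}) (A : 'M[F]_8) : galg C (subg_of U) :=
  #|U|%:R^-1 *: \sum_(u : subg_of U) (chi A (val u))^* *: gelt C u.

End Characters.
End Ree.

(* Main.v *)
(** On [V], right multiplication by [g] induces [f (x g) = f x * g' + f g],
where [g'] is a block of [g], so [f (x g)] depends on [x] only through [f x].
Row 1 of [Y(t1, t3, t4)] starts with [1, t1, - t3, t1 t3 - t4], hence [f]
restricts to a bijection from [U] onto [V], and [G] acts on the set [U] by
sending [y] to the unique element of [U] with the same value of [f] as [y g].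
The operation [*] is the linear extension of this action; it is right
multiplication when [g] lies in [U].  Since
[kappa(A.g, f(x g)) = kappa(A, f x) + kappa(A.g, f g)], it sends [[A]] to
[chi_(A.g)(g) [A.g]], and the [[A]] are a basis by orthogonality of the
characters of [V]. *)
Require Import Defs.
From mathcomp Require Import all_boot all_order all_fingroup all_algebra all_field.
From mathcomp Require Import reals.

Set Implicit Arguments.
Unset Strict Implicit.
Unset Printing Implicit Defensive.

Import GroupScope GRing.Theory Num.Theory.
Local Open Scope ring_scope.

(** * Linear extension of a right action on a finite group *)

Section PermutationModule.
Variables (C : fieldType) (H G : finGroupType) (act : H -> G -> H).
Hypothesis act1 : forall y, act y 1%g = y.
Hypothesis actM : forall y g h, act y (g * h)%g = act (act y g) h.

(* Linear extension of [gelt y . gelt g = gelt (act y g)], as a convolution. *)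
Definition perm_star (x : galg C H) (a : galg C G) : galg C H :=
  [ffun y => \sum_g (a g : C) * (x (act y g^-1%g) : C)].

Lemma perm_star_gelt x g y : perm_star x (gelt C g) y = x (act y g^-1%g).
Proof.
rewrite ffunE (bigD1 g) //= ffunE eqxx mul1r big1 ?addr0 // => h /negPf hg.
by rewrite ffunE hg mul0r.
Qed.

Lemma perm_star_gmodule : right_gmodule perm_star.
Proof.
split.
- move=> a k x y; apply/ffunP=> z; rewrite !ffunE scaler_sumr -big_split.
  by apply: eq_bigr => g _; rewrite !ffunE mulrDr; congr (_ + _); apply: mulrCA.
- move=> x k a b; apply/ffunP=> z; rewrite !ffunE scaler_sumr -big_split.
  by apply: eq_bigr => g _; rewrite !ffunE mulrDl; congr (_ + _); rewrite -mulrA.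
- move=> x; apply/ffunP=> z.
  by rewrite -gelt1 perm_star_gelt invg1 act1.
- move=> x a b; apply/ffunP=> z; rewrite !ffunE.
  transitivity (\sum_h \sum_g (a h : C) * (b (h^-1 * g)%g : C)
                  * (x (act z g^-1%g) : C)).
    by rewrite exchange_big; apply: eq_bigr => g _; rewrite ffunE mulr_suml.
  transitivity (\sum_h \sum_k (b k : C) * ((a h : C)
                  * (x (act (act z k^-1%g) h^-1%g) : C))).
    (* With [g = h * k], acting by [g^-1] is acting by [k^-1] and then by [h^-1]. *)
    apply: eq_bigr => h _; rewrite (reindex_inj (mulgI h)) /=.
    by apply: eq_bigr => k _; rewrite mulKg invMg actM -mulrA mulrCA.
  rewrite exchange_big; apply: eq_bigr => k _.
  by rewrite ffunE mulr_sumr.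
Qed.

End PermutationModule.

(** * Coefficients in the group algebra *)

Lemma galg_mul_gelt (C : fieldType) (H : finGroupType) (x : galg C H) (u y : H) :
  (x * gelt C u) y = x (y * u^-1)%g.
Proof.
rewrite ffunE (bigD1 (y * u^-1)%g) //= ffunE invMg invgK mulgKV eqxx mulr1.
rewrite big1 ?addr0 // => h hu; rewrite ffunE -(inj_eq (mulgI h)) mulKVg.
case: (y =P _) hu => [->|_ _]; first by rewrite mulgK eqxx.
by rewrite mulr0.
Qed.

Lemma galg_sumE (C : fieldType) (H : finGroupType) (I : Type) (r : seq I)
    (P : pred I) (a : I -> galg C H) y :
  (\sum_(i <- r | P i) a i) y = \sum_(i <- r | P i) (a i y : C).
Proof.
by apply: (big_morph (fun b : galg C H => b y : C)) => [b c|]; rewrite ffunE.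
Qed.

Lemma sum_geltE (C : fieldType) (H : finGroupType) (c : H -> C) y :
  (\sum_u c u *: gelt C u) y = c y.
Proof.
rewrite galg_sumE (bigD1 y) //= !ffunE eqxx big1 => [|u /negPf uy].
  by rewrite addr0; apply: mulr1.
by rewrite !ffunE eq_sym uy; apply: mulr0.
Qed.

(** * The space [V] and the trace form on it *)

Section Space.
Variable F : finFieldType.
Implicit Types (A B X Z H : 'M[F]_8) (g h x y : {'GL_8[F]}) (i j k : 'I_8).

(** Ordinals count from 0, so [0 < j < 4] singles out columns 2, 3 and 4. *)
Lemma projVE B i j :
  projV B i j = if (i == ix 1) && (0 < j < 4)%N then B i j else 0.
Proof.
rewrite !mxE; case: eqP => [->|_] /=; last by rewrite !mulr0 !addr0.
have e n : (0 < n <= 8)%N -> (j == ix n) = (val j == n.-1).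
  by move=> /andP[n0 n8]; rewrite -val_eqE /= inordK // prednK.
have r n : (0 < n <= 8)%N -> val j = n.-1 -> ix n = j.
  by move=> n8 jn; apply/esym/eqP; rewrite e // jn.
rewrite !e //; case: j e r => [[|[|[|[|j]]]] jlt] e r /=;
  rewrite ?mulr0 ?mulr1 ?addr0 ?add0r //.
- by rewrite (r 2).
- by rewrite (r 3).
- by rewrite (r 4).
Qed.

Lemma mem_projV B : projV B \in Vsp F.
Proof. by rewrite !memv_add // memvZ // memv_line. Qed.

Lemma projVD A B : projV (A + B) = projV A + projV B.
Proof.
apply/matrixP=> i j; rewrite projVE [RHS]mxE !projVE.
by case: ifP => _; rewrite ?mxE ?addr0.
Qed.

Lemma projV_id A : A \in Vsp F -> projV A = A.
Proof.
have pe n : (1 < n <= 4)%N -> projV (emx F 1 n) = emx F 1 n.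
  move=> n4; apply/matrixP=> i j; rewrite projVE !mxE.
  have -> : (j == ix n) = (val j == n.-1).
    by case: n n4 => [|[|[|[|[|n]]]]] //= _; rewrite -val_eqE /= inordK.
  case: (i == _) => //=; case: eqP => [->|_]; last by rewrite if_same.
  by case: n n4 => [|[|[|[|[|n]]]]].
have pZ a n : (1 < n <= 4)%N -> projV (a *: emx F 1 n) = a *: emx F 1 n.
  move=> n4; rewrite -[in RHS](pe n n4); apply/matrixP=> i j.
  by rewrite [RHS]mxE !projVE; case: ifP => _; rewrite ?mulr0 // mxE.
case/memv_addP=> B /memv_addP[_ /vlineP[a ->] [_ /vlineP[b ->] ->]].
case=> _ /vlineP[c ->] ->.
by rewrite !projVD !pZ.
Qed.

Lemma Vsp_notin A i j :
  A \in Vsp F -> ~~ ((i == ix 1) && (0 < j < 4)%N) -> A i j = 0.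
Proof. by move=> /projV_id <- /negPf ij; rewrite projVE ij. Qed.

Lemma kappa_projV A B :
  kappa A (projV B) = \sum_(j < 8 | (0 < j < 4)%N) A (ix 1) j * B (ix 1) j.
Proof.
rewrite /kappa /mxtrace [RHS]big_mkcond; apply: eq_bigr => j _.
rewrite mxE (bigD1 (ix 1)) //= big1 ?addr0 => [|i /negPf i1]; last first.
  by rewrite projVE i1 mulr0.
by rewrite mxE projVE eqxx /=; case: ifP; rewrite ?mulr0.
Qed.

Lemma kappaDl A B X : kappa (A + B) X = kappa A X + kappa B X.
Proof. by rewrite /kappa linearD mulmxDl linearD. Qed.

Lemma kappaNl A X : kappa (- A) X = - kappa A X.
Proof. by rewrite /kappa linearN mulNmx linearN. Qed.

Lemma kappaZl a A X : kappa (a *: A) X = a * kappa A X.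
Proof. by rewrite /kappa linearZ -scalemxAl linearZ. Qed.

Lemma kappaBr A B X : kappa A (B - X) = kappa A B - kappa A X.
Proof. by rewrite /kappa mulmxBr linearB. Qed.

Lemma kappa_nondeg B : B \in Vsp F -> B != 0 ->
  exists2 A, A \in Vsp F & kappa A B != 0.
Proof.
move=> BV; have B_id := projV_id BV; rewrite -B_id => B0.
suff [j] : exists j : 'I_8, projV B (ix 1) j != 0.
  rewrite projVE eqxx /=; case: ifP => [j4 Bj|_ /eqP//].
  exists (projV (delta_mx (ix 1) j)); first exact: mem_projV.
  rewrite kappa_projV (bigD1 j) //= big1 => [|k /andP[k4 /negPf kj]].
    by rewrite projVE eqxx j4 mxE !eqxx mul1r addr0.
  by rewrite projVE eqxx k4 mxE kj andbF mul0r.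
apply/existsP; apply: contraNT B0; rewrite negb_exists => /forallP B0.
apply/eqP/matrixP=> i j; rewrite [RHS]mxE.
have := B0 j; rewrite negbK !projVE eqxx.
by case: (i =P _) => //= -> /eqP.
Qed.

(** The trace form is symmetric, so its nondegeneracy passes to the other argument. *)
Lemma kappa_injl A B : A \in Vsp F -> B \in Vsp F ->
  (forall X, X \in Vsp F -> kappa A X = kappa B X) -> A = B.
Proof.
move=> AV BV AB; apply/eqP; rewrite -subr_eq0; apply: contraT => AB0.
have kC (M N : 'M[F]_8) : kappa M N = kappa N M.
  by rewrite /kappa -mxtrace_tr trmx_mul trmxK.
have [X XV] := kappa_nondeg (rpredB AV BV) AB0.
by rewrite kappaBr !(kC X) AB // subrr eqxx.
Qed.

End Space.

(** * Unitriangular matrices acting on [V] *)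

Section Unitriangular.
Variable F : finFieldType.
Let gT : finGroupType := {'GL_8[F]}.
Implicit Types (A B X Z H : 'M[F]_8) (g h x y : gT) (i j k : 'I_8).

Lemma mem_fV g : fV g \in Vsp F.
Proof. exact: mem_projV. Qed.

Lemma unitri_mxP B : reflect
  ((forall i, B i i = 1) /\ forall i j, (j < i)%N -> B i j = 0) (unitri_mx B).
Proof.
apply: (iffP andP) => [[/forallP d /forallP l]|[d l]]; split.
- by move=> i; apply/eqP.
- by move=> i j ji; have /forallP/(_ j) := l i; rewrite ji => /eqP.
- by apply/forallP=> i; rewrite d.
- by do 2!apply/forallP=> ?; apply/implyP=> /l ->.
Qed.

Lemma unitri_groupP g : reflect
  ((forall i, GLval g i i = 1) /\ forall i j, (j < i)%N -> GLval g i j = 0)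
  (g \in unitri_group F).
Proof. by rewrite inE; apply: unitri_mxP. Qed.

Lemma eq_fVP g h : (fV g = fV h) <->
  (forall j, (0 < j < 4)%N -> GLval g (ix 1) j = GLval h (ix 1) j).
Proof.
split=> [gh j j4|gh].
  by have /matrixP/(_ (ix 1) j) := gh; rewrite !projVE eqxx j4.
apply/matrixP=> i j; rewrite !projVE.
by case: (i =P _) => //= ->; case: ifP => // /gh.
Qed.

(** Column [j] of [g] vanishes below row [j], so columns 2, 3 and 4 of the first row of [x * g]
    involve only the first four entries of that row of [x]: a leading 1 and the entries recorded by
    [fV x]. *)
Lemma fV_mulr x y g : x \in unitri_group F -> y \in unitri_group F ->
  g \in unitri_group F -> fV x = fV y -> fV (x * g) = fV (y * g).
Proof.
move=> /unitri_groupP[xd _] /unitri_groupP[yd _] /unitri_groupP[_ gl].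
move=> /eq_fVP xy; apply/eq_fVP=> j /andP[j0 j4].
rewrite !GL_MxE !mxE; apply: eq_bigr => k _.
case: (ltnP j k) => [/gl ->|kj]; first by rewrite !mulr0.
congr (_ * _); case: (posnP k) => [k0|k_gt0].
  have -> : k = ix 1 by apply/val_inj; rewrite /= inordK.
  by rewrite xd yd.
by apply: xy; rewrite k_gt0 (leq_ltn_trans kj).
Qed.

Lemma actV_in A g : actV A g \in Vsp F.
Proof. exact: mem_projV. Qed.

(** In the full product the first term is [B (ix 1) k], as [A] has corner entry 1, and the terms
    beyond column 4 vanish because [B] is upper triangular. *)
Lemma mulmx_row1 A B k : A (ix 1) (ix 1) = 1 ->
    (forall i j, (j < i)%N -> B i j = 0) -> (0 < k < 4)%N ->
  \sum_(j < 8 | (0 < j < 4)%N) A (ix 1) j * B j k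
    = (A *m B) (ix 1) k - B (ix 1) k.
Proof.
move=> A1 Bl /andP[k0 k4].
rewrite mxE [in RHS](bigD1 (ix 1)) //= A1 mul1r addrAC subrr add0r.
rewrite [RHS](bigID (fun j : 'I_8 => (0 < j < 4)%N)) /= [X in _ = _ + X]big1.
  rewrite addr0; apply: eq_bigl => j; case: eqP => [->|] //.
  by rewrite inordK // andbF.
move=> j /andP[j1 j4]; rewrite Bl ?mulr0 //; apply: (leq_trans k4).
move: j4; rewrite negb_and -!leqNgt leqn0 => /orP[] // j0.
by case/negP: j1; rewrite -val_eqE /= inordK.
Qed.

(* The first row of [X = Z *m H] expresses [projV X] through [projV Z]. *)
Lemma kappa_projV_trmul A X Z H : A \in Vsp F -> X = Z *m H ->
    Z (ix 1) (ix 1) = 1 -> (forall i j, (j < i)%N -> H i j = 0) ->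
  kappa (projV (A *m H^T)) (projV Z) = kappa A (projV X) - kappa A (projV H).
Proof.
move=> AV XZH Z1 Hl; rewrite !kappa_projV -sumrB.
transitivity (\sum_(k < 8 | (0 < k < 4)%N) \sum_(j < 8 | (0 < j < 4)%N)
    A (ix 1) k * (Z (ix 1) j * H j k)); last first.
  by apply: eq_bigr => k k4; rewrite -mulr_sumr mulmx_row1 // -XZH mulrBr.
rewrite exchange_big; apply: eq_bigr => j j4; rewrite projVE eqxx j4 mxE.
rewrite mulr_suml (bigID (fun k : 'I_8 => (0 < k < 4)%N)) /=.
(* Since [A] lies in [V], its first row is zero outside columns 2, 3 and 4. *)
rewrite [X in _ + X]big1 ?addr0 => [|k k4]; last first.
  by rewrite (Vsp_notin AV) ?eqxx ?mul0r.
by apply: eq_bigr => k _; rewrite mxE mulrAC -mulrA.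
Qed.

Lemma invmx_unitri g :
  g \in unitri_group F -> forall i j, (j < i)%N -> invmx (GLval g) i j = 0.
Proof. by move/groupVr/unitri_groupP=> [_ gl] i j /gl. Qed.

(** The preceding formula is applied to [x = (x * g) * g^-1] and to [1 = g * g^-1]. Both produce the
    term [- kappa A (projV (invmx (GLval g)))], and the identity matrix contributes nothing in
    columns 2, 3 and 4. *)
Lemma kappa_actV_mul A x g : A \in Vsp F -> x \in unitri_group F ->
    g \in unitri_group F ->
  kappa (actV A g) (fV (x * g))
    = kappa A (fV x) + kappa (actV A g) (fV g).
Proof.
move=> AV xG gG; have gl := invmx_unitri gG.
have /unitri_groupP[xgd _] := groupM xG gG.
have /unitri_groupP[gd _] := gG.
have gV : GLval g *m invmx (GLval g) = 1%:M by rewrite mulmxV // GL_unitmx.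
have xE : GLval x = GLval (x * g) *m invmx (GLval g).
  by rewrite GL_MxE -mulmxA gV mulmx1.
rewrite /actV /fV (kappa_projV_trmul AV xE (xgd _) gl).
rewrite (kappa_projV_trmul AV (esym gV) (gd _) gl) [X in _ + (X - _)]kappa_projV.
rewrite [X in _ + (X - _)]big1 ?sub0r // => j /andP[j0 _].
by rewrite mxE -val_eqE /= inordK // ltn_eqF // mulr0.
Qed.

End Unitriangular.

(** * The bijection from [U] onto [V] and the action of [G] on [U] *)

Section ReeSylow.
Variables (F : finFieldType) (m : nat).
Hypothesis cardF : #|F| = (3 ^ (2 * m + 1))%N.
Implicit Types (A B : 'M[F]_8).

Let gT : finGroupType := {'GL_8[F]}.
Let U := ree_syl_group cardF.
Let G := unitri_group F.

Lemma natr3_eq0 : 3%:R = 0 :> F.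
Proof. by apply: pcharf0; apply: card_finPcharP cardF _. Qed.

Lemma Ymx_row1 (t1 t3 t4 : F) :
  [/\ Ymx m t1 t3 t4 (ix 1) (ix 2) = t1,
      Ymx m t1 t3 t4 (ix 1) (ix 3) = - t3
    & Ymx m t1 t3 t4 (ix 1) (ix 4) = t1 * t3 - t4].
Proof.
rewrite YmxE; set A1 := t1 ^+ _; set A3 := t3 ^+ _; set A4 := t4 ^+ _.
have F3 := natr3_eq0.
(* The powers [A1], [A3], [A4] count as independent variables, so the entries can be compared as
   formal polynomials; zeros fill the remaining slots. *)
pose x := [:: t1; t3; t4; A1; A3; A4; 0; 0; 0; 0; 0; 0].
have v i : (i < 12)%N -> x`_i = pev x (pv i) by move=> ?; rewrite pv_ev.
rewrite -[t1]/x`_0 -[t3]/x`_1 -[t4]/x`_2 -[A1]/x`_3 -[A3]/x`_4 -[A4]/x`_5.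
rewrite !v // -(pY_ev F3); set P := pY _ _ _ _ _ _.
have /and3P[P2 P3 P4] : [&& peq (pent P 0 1) (pv 0),
    peq (pent P 0 2) (popp (pv 1))
  & peq (pent P 0 3) (padd (pmul (pv 0) (pv 1)) (popp (pv 2)))] by vm_compute.
move: P P2 P3 P4 => P /(peq_ev F3 x) P2 /(peq_ev F3 x) P3 /(peq_ev F3 x) P4.
by split; rewrite mxE !inordK //= ?P2 ?P3 ?P4
  ?(padd_ev F3) ?(popp_ev F3) ?(pmul_ev F3).
Qed.

Lemma fV_ree_inj : {in U &, injective (@fV F)}.
Proof.
move=> g h; rewrite !inE.
case/existsP=> t1 /existsP[t3 /existsP[t4 /eqP gE]].
case/existsP=> s1 /existsP[s3 /existsP[s4 /eqP hE]] /eq_fVP.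
rewrite gE hE => gh; apply: val_inj; rewrite /= gE hE.
have [Y2 Y3 Y4] := Ymx_row1 t1 t3 t4; have [Z2 Z3 Z4] := Ymx_row1 s1 s3 s4.
have := gh (ix 2); rewrite Y2 Z2 inordK // => /(_ isT) e1.
have := gh (ix 3); rewrite Y3 Z3 inordK // => /(_ isT)/oppr_inj e3.
have := gh (ix 4); rewrite Y4 Z4 inordK // e1 e3 => /(_ isT)/addrI/oppr_inj ->.
by [].
Qed.

Lemma fV_ree_surj A : A \in Vsp F -> exists2 u, u \in U & fV u = A.
Proof.
move=> AV; pose a n := A (ix 1) (ix n).
(* The parameters solve [t1 = a 2], [- t3 = a 3], [t1 * t3 - t4 = a 4]. *)
have [u uU uE] := mem_ree_syl cardF (a 2) (- a 3) (- (a 2 * a 3) - a 4).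
exists u => //; rewrite -(projV_id AV) /fV /projV uE.
have [-> -> ->] := Ymx_row1 (a 2) (- a 3) (- (a 2 * a 3) - a 4).
by rewrite opprK mulrN opprB addrCA subrr addr0.
Qed.

Lemma card_Vsp : #|Vsp F| = #|U|.
Proof.
rewrite -(card_in_imset fV_ree_inj); apply: eq_card => A.
apply/idP/imsetP=> [/fV_ree_surj[u uU <-]|[u _ ->]]; first by exists u.
exact: mem_fV.
Qed.

(* The casts to [gT] select the product of the [finGroupType] structure, which
   unifies much faster with the lemmas on [G] than that of the matrix type. *)
Definition ree_act (y : subg_of U) (g : subg_of G) : subg_of U :=
  odflt 1%g [pick u : subg_of U | fV (val u) == fV ((val y : gT) * (val g : gT))].

(** Surjectivity of [fV] on [U] means that the default [1] in [ree_act] is never reached for want of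
    a candidate. *)
Lemma fV_ree_act y g : fV (val (ree_act y g)) = fV ((val y : gT) * (val g : gT)).
Proof.
rewrite /ree_act; case: pickP => [u /eqP //|no].
have [u uU uE] := fV_ree_surj (mem_fV ((val y : gT) * (val g : gT))).
by have := no (subg U u); rewrite /= subgK // uE eqxx.
Qed.

Lemma mem_subg_unitri (u : subg_of U) : val u \in G.
Proof. by apply: (subsetP (ree_syl_sub cardF)); apply: subgP. Qed.

Lemma ree_act_eq y g (u : subg_of U) :
  fV (val u) = fV ((val y : gT) * (val g : gT)) -> ree_act y g = u.
Proof.
move=> uE; apply/val_inj/fV_ree_inj; rewrite ?fV_ree_act //; exact: subgP.
Qed.

Lemma ree_act1 y : ree_act y 1%g = y.
Proof. by apply: ree_act_eq; rewrite mulg1. Qed.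

Lemma ree_actM y g h : ree_act y (g * h)%g = ree_act (ree_act y g) h.
Proof.
apply/ree_act_eq/(etrans (fV_ree_act _ _)); rewrite mulgA; apply: fV_mulr.
- exact: mem_subg_unitri.
- by rewrite groupM ?subgP ?mem_subg_unitri.
- exact: subgP.
- exact: fV_ree_act.
Qed.

Lemma ree_act_subg y (u : subg_of U) :
  ree_act y (subg G (val u)) = (y * u)%g.
Proof. by apply: ree_act_eq; rewrite /= subgK ?mem_subg_unitri. Qed.

(** By [kappa_actV_mul], [actV A g] determines [kappa A (fV u)] for every [u] in [U]; these [fV u]
    exhaust [V], so nondegeneracy recovers [A]. *)
Lemma actV_inj (g : gT) :
  g \in G -> {in Vsp F &, injective (fun A => actV A g)}.
Proof.
move=> gG A B AV BV AB; apply: kappa_injl => // X /fV_ree_surj[u uU <-].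
have uG : u \in G by apply: (subsetP (ree_syl_sub cardF)).
apply: (addIr (kappa (actV A g) (fV g))); rewrite -kappa_actV_mul // AB.
by rewrite kappa_actV_mul.
Qed.

(** * Character sums, the basis of the [[A]] and its monomial behaviour *)

Section Characters.
Variables (C : numClosedFieldType) (vth : F -> C).
Hypothesis vth_char : nontrivial_linear_char vth.

Lemma linear_charD x y : vth (x + y) = vth x * vth y.
Proof. by case: vth_char. Qed.

Lemma linear_char0 : vth 0 = 1.
Proof.
have [n0 _ _] := vth_char; apply: (mulfI (n0 0)).
by rewrite -linear_charD addr0 mulr1.
Qed.

(** In characteristic 3 the cube of [vth x] is [vth 0 = 1], so [vth x] has modulus 1 and its
    conjugate is its inverse. *)
Lemma linear_charC x : (vth x)^* = vth (- x).
Proof.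
have [n0 _ _] := vth_char.
have /eqP : `|vth x| ^+ 3 = 1.
  rewrite -normrX !exprS expr0 mulr1 -!linear_charD -mulr2n -mulrS -mulr_natl.
  by rewrite natr3_eq0 mul0r linear_char0 normr1.
rewrite pexpr_eq1 // => /eqP x1; apply: (mulfI (n0 x)).
by rewrite -normCK x1 expr1n -linear_charD subrr linear_char0.
Qed.

Lemma sum_linear_char B : B \in Vsp F ->
  \sum_(A in Vsp F) vth (kappa A B) = if B == 0 then #|Vsp F|%:R else 0.
Proof.
move=> BV; case: eqVneq => [->|B0].
  rewrite -sumr_const; apply: eq_bigr => A _.
  by rewrite /kappa mulmx0 linear0 linear_char0.
have [_ _ [x x1]] := vth_char; have [A0 A0V kA0] := kappa_nondeg BV B0.
(* Translation by [D] permutes [V] and multiplies the sum by [vth x], which is not 1; hence the sum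
   is 0. *)
pose D := (x / kappa A0 B) *: A0.
have kD : kappa D B = x by rewrite kappaZl divfK.
have DV : D \in Vsp F by apply: memvZ.
set S := LHS; have : S = vth x * S.
  rewrite {1}/S (reindex_inj (addrI D)) mulr_sumr /=.
  apply: eq_big => A; first by rewrite rpredDl.
  by rewrite kappaDl linear_charD kD.
move/eqP; rewrite -[X in X == _]mul1r -subr_eq0 -mulrBl mulf_eq0.
by rewrite subr_eq0 eq_sym (negPf x1) => /eqP.
Qed.

Lemma lcbE A z : lcb vth U A z = #|U|%:R^-1 * vth (- kappa A (fV (val z))).
Proof. by rewrite ffunE sum_geltE -linear_charC. Qed.

(** Fourier inversion: orthogonality leaves only the coefficient at [z = u], since [fV] is injective
    on [U]. *)
Lemma gelt_lcb (u : subg_of U) :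
  gelt C u = \sum_(A in Vsp F) chi vth A (val u) *: lcb vth U A.
Proof.
apply/ffunP=> z; rewrite galg_sumE ffunE.
transitivity (#|U|%:R^-1 *
    \sum_(A in Vsp F) vth (kappa A (fV (val u) - fV (val z)))).
  rewrite sum_linear_char ?rpredB ?mem_fV // subr_eq0.
  have -> : (fV (val u) == fV (val z)) = (z == u).
    apply/eqP/eqP=> [uz|-> //].
    by apply/val_inj/fV_ree_inj; rewrite ?subgP.
  case: eqP => _; last by rewrite mulr0.
  by rewrite card_Vsp mulVf // pnatr_eq0 -lt0n cardG_gt0.
rewrite mulr_sumr; apply: eq_bigr => A _; rewrite [RHS]ffunE lcbE.
by rewrite kappaBr linear_charD mulrCA.
Qed.

(** Fourier inversion shows that the family spans, and its length [#|Vsp F| = #|U|] is the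
    dimension. *)
Lemma lcb_basis :
  basis_of {:galg C (subg_of U)} [seq lcb vth U A | A : 'M[F]_8 in Vsp F].
Proof.
rewrite basisEdim; apply/andP; split; last first.
  by rewrite size_image card_Vsp dimvf /= /dim /= muln1 card_sub.
apply/subvP=> a _.
have -> : a = \sum_u (a u : C) *: gelt C u.
  by apply/ffunP=> z; rewrite sum_geltE.
apply: memv_suml => u _; apply: memvZ; rewrite gelt_lcb.
by apply: memv_suml => A AV; apply/memvZ/memv_span/image_f.
Qed.

Lemma lcb_star A (g : subg_of G) : A \in Vsp F ->
  perm_star ree_act (lcb vth U A) (gelt C g) =
    chi vth (actV A (val g)) (val g) *: lcb vth U (actV A (val g)).
Proof.
move=> AV; apply/ffunP=> z; rewrite perm_star_gelt [RHS]ffunE !lcbE.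
(* Writing [z] as the image of [y] under [g] makes [kappa_actV_mul] applicable to [fV (y * g)]. *)
have : z = ree_act (ree_act z g^-1%g) g by rewrite -ree_actM mulVg ree_act1.
move: (ree_act z _) => y ->.
rewrite fV_ree_act kappa_actV_mul ?mem_subg_unitri ?subgP //.
rewrite opprD linear_charD /chi [RHS]mulrCA; congr (_ * _).
by rewrite mulrCA -linear_charD subrr linear_char0 mulr1.
Qed.

Lemma perm_star_ree_monomial : monomial_gmodule (@perm_star C _ _ ree_act).
Proof.
split; first by apply: perm_star_gmodule; [exact: ree_act1 | exact: ree_actM].
exists #|Vsp F|, (image_tuple (lcb vth U) (Vsp F)); split; first exact: lcb_basis.
(* The basis is indexed by the enumeration of [V]; [r] returns the index of a vector, and [A] to
   [A.g] becomes a permutation of indices. *)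
move=> g; pose r := enum_rank_in (mem0v (Vsp F)).
have rK : {in Vsp F, cancel r enum_val} by move=> A; apply: enum_rankK_in.
have s_inj : injective (fun i : 'I_#|Vsp F| => r (actV (enum_val i) (val g))).
  move=> i j /(congr1 enum_val); rewrite !rK ?actV_in // => /actV_inj ij.
  by apply: enum_val_inj; apply: ij; rewrite ?subgP ?enum_valP.
have tE i : tnth (image_tuple (lcb vth U) (Vsp F)) i = lcb vth U (enum_val i).
  by rewrite (tnth_nth 0) nth_image.
exists (perm s_inj).
exists (fun i => chi vth (actV (enum_val i) (val g)) (val g)) => i; split.
  by have [n0 _ _] := vth_char; apply: n0.
by rewrite !tE permE lcb_star ?enum_valP // rK ?actV_in.
Qed.

End Characters.

End ReeSylow.

Theorem theorem4p11 (R : realType) (F : finFieldType) (m : nat)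
    (cardF : #|F| = (3 ^ (2 * m + 1))%N)
    (vth : F -> R[i]) (vth_char : nontrivial_linear_char vth) :
  let G := unitri_group F in
  let U := ree_syl_group cardF in
  let CU := galg R[i] (subg_of U) in
  let CG := galg R[i] (subg_of G) in
  let br (A : 'M[F]_8) : CU := lcb vth U A in
  [/\ forall (A : 'M[F]_8) (u : {'GL_8[F]}), A \in Vsp F -> u \in U ->
        chi vth A u = (chi vth (- A) u)^*,
      basis_of {:CU} [seq br A | A : 'M[F]_8 in Vsp F]
    & exists star : CU -> CG -> CU,
      [/\ forall (A : 'M[F]_8) (g : subg_of G), A \in Vsp F ->
            star (br A) (gelt R[i] g) =
              chi vth (actV A (val g)) (val g) *: br (actV A (val g)),
          monomial_gmodule star,
          forall (x : CU) (u : subg_of U),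
            star x (gelt R[i] (subg G (val u))) = x * gelt R[i] u
        & forall (A : 'M[F]_8) (u : subg_of U), A \in Vsp F ->
            br A * gelt R[i] u =
              #|U|%:R^-1 *: \sum_(y : subg_of U)
                (chi vth A (val y))^* *: gelt R[i] (y * u)%g]].
Proof.
move=> G U CU CG br; split.
- by move=> A u _ _; rewrite /chi (linear_charC cardF vth_char) kappaNl opprK.
- exact: lcb_basis vth_char.
exists (perm_star (@ree_act _ _ cardF)); split.
- by move=> A g AV; apply: lcb_star.
- exact: perm_star_ree_monomial vth_char.
(* Elements of [U] act by right translation, and [subg G], a morphism on [G], commutes with the
   inverse. *)
- move=> x u; apply/ffunP=> y; rewrite perm_star_gelt galg_mul_gelt.
  by rewrite -ree_act_subg morphV ?mem_subg_unitri.
- move=> A u AV; rewrite /br /lcb -scalerAl mulr_suml; congr (_ *: _).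
  by apply: eq_bigr => y _; rewrite -scalerAl geltM.
Qed.
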